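(* Let $b$ be a prime, $m\ge 5$ an integer, $N=b^m$, let $(\gamma_j)_{j\ge1}$ be a non-increasing sequence of weights with $0<\gamma_j\le 1$, and let $0\le w_1\le w_2\le\cdots$ be integers. Then there exists a generating vector $\mathbf{z}=(b^{w_1}z_1,\dots,b^{w_s}z_s)$ with $z_j\in\mathcal{Z}_{N,w_j}$ for all $j\in[s]$ such that the lattice point set $P_N(\mathbf{z})$ satisfies \begin{align*} D_{N,\boldsymbol{\gamma}}^*(\mathbf{z}) &\le \sum_{\mathfrak{u}\subseteq[s]}\gamma_{\mathfrak{u}}\left(1-\left(1-\frac1N\right)^{|\mathfrak{u}|}\right) + \frac12\Bigg(\frac1N\prod_{j=1}^s(\beta_j+\gamma_jS_N) \\ &\quad + \frac1N\sum_{p=0}^{m-1} b^{m-p-1}(b-1)\prod_{\substack{j=1\\ w_j\ge m-p}}^{s}(\beta_j+\gamma_jS_N)\prod_{\substack{j=1\\ w_j<m-p}}^{s}\beta_j - \prod_{j=1}^s\beta_j\Bigg), \end{align*} where $\beta_j=1+\gamma_j$.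
   Context: Notation: $[s]=\{1,\dots,s\}$. Product weights: $\gamma_{\mathfrak{u}}=\prod_{j\in\mathfrak{u}}\gamma_j$ for $\mathfrak{u}\subseteq[s]$, $\gamma_\emptyset=1$. For an integer $w\ge0$, $\mathcal{Z}_{N,w}=\{z\in\{1,\dots,b^{m-w}-1\}:\gcd(z,b^m)=1\}$ if $w<m$, and $\mathcal{Z}_{N,w}=\{1\}$ if $w\ge m$. For $\mathbf{z}\in\mathbb{Z}^s$ the lattice point set is $P_N(\mathbf{z})=\{\{k\mathbf{z}/N\}:k=0,\dots,N-1\}$ (fractional parts componentwise). For a point set $P_N$ of $N$ points in $[0,1)^s$ and $\mathbf{x}\in[0,1]^s$, $\mathrm{discr}(\mathbf{x},P_N)=\frac1N\#\{\mathbf{p}\in P_N:\mathbf{p}\in[\mathbf{0},\mathbf{x})\}-\prod_{j=1}^s x_j$. The weighted star discrepancy is $D^*_{N,\boldsymbol\gamma}(\mathbf{z})=\sup_{\mathbf{x}\in(0,1]^s}\max_{\emptyset\ne\mathfrak{u}\subseteq[s]}\gamma_{\mathfrak{u}}|\mathrm{discr}((\mathbf{x}_{\mathfrak{u}},\mathbf{1}),P_N(\mathbf{z}))|$, where $(\mathbf{x}_{\mathfrak{u}},\mathbf{1})$ has $j$-th coordinate $x_j$ for $j\in\mathfrak{u}$ and $1$ otherwise. $S_N=\sum_{-N/2<h\le N/2,\,h\ne0}\frac{1}{|h|}$. *)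

(* Defs.v *)
From HB Require Import structures.
From mathcomp Require Import all_boot all_order all_algebra.
From mathcomp Require Import all_classical all_reals.
Set Implicit Arguments. Unset Strict Implicit. Unset Printing Implicit Defensive.
Import Order.TTheory GRing.Theory Num.Theory.
Local Open Scope classical_set_scope.
Local Open Scope ring_scope.

(* Coordinates are indexed 0-based by 'I_s: coordinate j : 'I_s of the paper's
   index j+1. Weights gamma and w are sequences nat -> _, gamma j / w j being
   the paper's gamma_{j+1} / w_{j+1}. *)

Definition inZ (b m w z : nat) : bool :=
  if (w < m)%N then [&& (1 <= z)%N, (z <= b ^ (m - w) - 1)%N & coprime z (b ^ m)]
  else z == 1%N.

Definition lat_pt (R : realType) (N : nat) (s : nat) (z : 'I_s -> nat)
  (k : nat) (j : 'I_s) : R :=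
  ((k * z j) %% N)%:R / N%:R.

Definition restr (R : realType) (s : nat) (u : {set 'I_s}) (x : 'I_s -> R)
  : 'I_s -> R := fun j => if j \in u then x j else 1.

Definition discr (R : realType) (N s : nat) (z : 'I_s -> nat) (x : 'I_s -> R) : R :=
  (#|[set k : 'I_N | [forall j, lat_pt R N z k j < x j]]|%:R / N%:R)
  - \prod_(j < s) x j.

Definition gammaU (R : realType) (s : nat) (gamma : nat -> R) (u : {set 'I_s}) : R :=
  \prod_(j in u) gamma j.

Definition Dstar (R : realType) (N s : nat) (gamma : nat -> R) (z : 'I_s -> nat) : R :=
  sup [set r : R | exists x : 'I_s -> R,
        (forall j, 0 < x j <= 1) /\
        exists u : {set 'I_s}, (0 < #|u|)%N /\
          r = gammaU gamma u * `|discr N z (restr u x)|].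

Definition S_N (R : realType) (N : nat) : R :=
  \sum_(k < (2 * N).+1)
    (let h : int := (k%:Z - N%:Z)%R in
     if [&& (- (N%:R / 2) < (h%:~R : R)), ((h%:~R : R) <= N%:R / 2) & h != 0]
     then ((`|h|%:~R : R))^-1 else 0).

(* Main.v *)
Require Import Defs.
From HB Require Import structures.
From mathcomp Require Import all_boot all_order all_algebra.
From mathcomp Require Import all_classical all_reals.
From mathcomp Require Import zify ring lra.
From mathcomp Require Import topology normedtype derive trigo complex.
Set Implicit Arguments. Unset Strict Implicit. Unset Printing Implicit Defensive.
Import Order.TTheory GRing.Theory Num.Theory.
Import numFieldNormedType.Exports.
Local Open Scope ring_scope.

(** Rounding [x] up to the grid [N^-1 Z^s] costs at most [1 - (1 - 1/N)^|u|].  On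
    the grid, the indicator of a box is expanded in the characters of [Z/N]; its
    nonzero Fourier coefficients are at most [1/(2|h|)] because [sin] lies above
    its chord on [[0, pi/2]], and averaging over the lattice points leaves only
    the frequencies of the dual lattice.  This bounds the discrepancy, for every
    [z], by half a sum over the nonzero dual vectors.

    That sum is averaged over all admissible [z] at once.  Written as a sum over
    [k < N], the average splits into a product over the coordinates.  The factor
    of coordinate [j] is [beta_j + gamma_j S_N] when [N] divides [k b^(w_j)];
    otherwise a Ramanujan sum evaluates it to [beta_j] plus a multiple of
    [gamma_j (S_(b^i) - S_(b^(i+1)))], and it stays in [[0, beta_j]].  Grouping the [k] by
    their [b]-adic valuation gives the bound, and some [z] is at most the average. *)

(** * Harmonic sums over residues modulo [N] *)

Section Harmonic.
Variable R : realFieldType.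
(* A residue [c < N] stands for the [h] congruent to [c] in [(-N/2, N/2]]; then
   [|h| = minn c (N - c)] and [rho N c = 1/|h|], with [rho N 0 = 0] since [0^-1 = 0]. *)
Definition rho (N c : nat) : R := (minn c (N - c))%:R^-1.
Definition harm (N : nat) : R := \sum_(c < N) rho N c.
Let H (n : nat) : R := \sum_(0 <= c < n) c%:R^-1.

Lemma rho_ge0 N c : 0 <= rho N c.
Proof. by rewrite invr_ge0. Qed.

Lemma rho0 N : rho N 0 = 0.
Proof. by rewrite /rho min0n invr0. Qed.

Lemma rho_scale d N c : rho (d * N) (d * c) = d%:R^-1 * rho N c.
Proof. by rewrite /rho -mulnBr -minnMr natrM invfM. Qed.

Lemma harm_halves N : (0 < N)%N -> harm N = H (N./2).+1 + H (uphalf N).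
Proof.
move=> N0; rewrite /harm -(big_mkord xpredT (rho N)).
rewrite (@big_cat_nat _ _ _ (minn (N./2).+1 N)) //=; last lia.
congr (_ + _).
  have [N1|N1] := leqP N 1.
    have -> : N = 1%N by lia.
    by rewrite /H /minn /= !big_nat1 rho0 invr0.
  rewrite (minn_idPl _); last lia.
  by apply: eq_big_nat => i hi; rewrite /rho; congr (_%:R^-1); lia.
rewrite /H [RHS]big_ltn; last lia.
rewrite invr0 add0r big_nat_rev /= big_add1.
have [N1|N1] := leqP N 1.
  by rewrite !big_geq //; lia.
rewrite -[X in \sum_(X <= _ < _) _]add0n (minn_idPl _); last lia.
rewrite big_addn; have -> : (N - (N./2).+1 = (uphalf N).-1)%N by lia.
by apply: eq_big_nat => i hi; rewrite /rho; congr (_%:R^-1); lia.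
Qed.

(** Passing from [N] to [N + 1] swaps the two halves and lengthens just one of them, by a single
    term. *)
Lemma harmS N : (0 < N)%N -> harm N.+1 = harm N + (uphalf N)%:R^-1.
Proof.
move=> N0; rewrite !harm_halves //.
have -> : (N.+1./2 = uphalf N) by lia.
have -> : (uphalf N.+1 = (N./2).+1) by lia.
have -> : H (uphalf N).+1 = H (uphalf N) + (uphalf N)%:R^-1 by rewrite /H big_nat_recr.
ring.
Qed.

Lemma harm_le M K : (0 < M)%N -> (M <= K)%N -> harm M <= harm K.
Proof.
move=> M0 /subnK <-; elim: (K - M)%N => // n IH.
by rewrite addSn harmS ?addn_gt0 ?M0 ?orbT // (le_trans IH) // lerDl invr_ge0.
Qed.

(** Each of the [K - M] increments is [1/uphalf n] for some [n >= M], hence at most [2/M]. *)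
Lemma harm_sub_le M K : (0 < M)%N -> (M <= K)%N ->
  harm K - harm M <= 2 * (K - M)%N%:R / M%:R.
Proof.
move=> M0 /[dup] le /subnK; move: (K - M)%N => n <-.
elim: n {K le} => [|n IH]; first by rewrite subrr mulr0 mul0r.
have M0' : (0 : R) < M%:R by rewrite ltr0n.
rewrite addSn harmS ?addn_gt0 ?M0 ?orbT // addrAC -(natr1 n) mulrDr mulrDl.
apply: lerD => //.
have h0 : (0 : R) < (uphalf (n + M))%:R by rewrite ltr0n; lia.
rewrite mulr1 ler_pdivlMr // mulrC ler_pdivrMr //.
by rewrite -natrM ler_nat; lia.
Qed.

(** Each block [[d M, d M + d)] contains a single multiple of [d], its first element. *)
Lemma big_dvd (V : nmodType) d M (F : nat -> V) : (0 < d)%N ->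
  \sum_(c < d * M | (d %| c)%N) F c = \sum_(c < M) F (d * c)%N.
Proof.
move=> d0; rewrite -(big_mkord (fun c => d %| c)%N) -(big_mkord xpredT (fun c => F (d * c)%N)).
elim: M => [|M IH]; first by rewrite muln0 !big_geq.
rewrite mulnSr (@big_cat_nat _ _ _ (d * M)) ?leq_addr //= IH big_nat_recr //=; congr (_ + _).
rewrite big_ltn_cond ?dvdn_mulr //; last lia.
rewrite big_nat_cond big_pred0 ?addr0 // => i.
apply/negP=> /andP[/andP[lo hi] /dvdnP[q e]]; move: lo hi.
by rewrite e -mulnSr (mulnC q) !ltn_pmul2l // => ? ?; lia.
Qed.

Lemma sum_rho_dvd N d M : (0 < d)%N -> N = (d * M)%N ->
  \sum_(c < N | (d %| c)%N) rho N c = d%:R^-1 * harm M.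
Proof.
by move=> d0 ->; rewrite big_dvd // mulr_sumr; apply: eq_bigr => i _; rewrite rho_scale.
Qed.
End Harmonic.

(** Split at [k = N]: the frequencies [0 <= h <= N/2] give the first sum of [harm_halves], and
    [-N/2 < h < 0] the second. The excluded [h = 0] is matched by [0^-1 = 0]. *)
Lemma S_NE (R : realType) N : (0 < N)%N -> S_N R N = harm R N.
Proof.
move=> N0; rewrite harm_halves // /S_N.
pose F k : R := let h := k%:Z - N%:Z in
     if [&& (- (N%:R / 2) < (h%:~R : R)), ((h%:~R : R) <= N%:R / 2) & h != 0]
     then ((`|h|%:~R : R))^-1 else 0.
rewrite (eq_bigr (fun k : 'I_(2*N).+1 => F k)) // -(big_mkord xpredT F).
rewrite (@big_cat_nat _ _ _ N) //=; last lia.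
rewrite addrC; congr (_ + _).
  rewrite -{1}[N]add0n big_addn.
  have -> : ((2 * N).+1 - N = N.+1)%N by lia.
  have E i : F (i + N)%N = if (i <= N./2)%N then i%:R^-1 else 0.
    rewrite /F PoszD addrK /=.
    have [->|i0] := eqVneq i 0%N.
      by rewrite eqxx /= !andbF invr0.
    have -> : (- (N%:R / 2) < (i%:R : R)).
      by apply: (@lt_le_trans _ _ 0); rewrite ?ler0n // oppr_lt0 divr_gt0 // ltr0n.
    rewrite ler_pdivlMr // -natrM ler_nat /=.
    by have -> : (i * 2 <= N)%N && (i%:Z != 0) = (i <= N./2)%N by lia.
  rewrite (eq_bigr _ (fun i _ => E i)) (@big_cat_nat _ _ _ (N./2).+1) //=; last lia.
  rewrite [X in _ + X]big1_seq ?addr0.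
    by apply: eq_big_nat => i hi; rewrite (_ : (i <= _)%N) //; lia.
  by move=> i; rewrite mem_index_iota => hi /=; rewrite ifF //; lia.
rewrite big_nat_rev /= [RHS]big_ltn ?uphalf_gt0 // invr0 add0r.
have E i : (0 <= i < N)%N -> F (N - i.+1)%N = if (i.+1 < uphalf N)%N then i.+1%:R^-1 else 0.
  move=> hi; rewrite /F.
  have -> : (N - i.+1)%N%:Z - N%:Z = - i.+1%:Z by lia.
  have -> : ((- i.+1%:Z)%:~R <= (N%:R / 2 : R)).
    by rewrite mulrNz (@le_trans _ _ 0) ?oppr_le0 ?ler0n // divr_ge0.
  rewrite mulrNz ltrN2 ltr_pdivlMr // -natrM ltr_nat /= normrN.
  by have -> : ((i.+1 * 2 < N)%N && (- i.+1%:Z != 0)) = (i.+1 < uphalf N)%N by lia.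
rewrite add0n (eq_big_nat _ _ E).
rewrite (@big_cat_nat _ _ _ (uphalf N).-1) //=; last lia.
rewrite [X in _ + X]big1_seq ?addr0.
  rewrite big_add1; apply: eq_big_nat => i hi; rewrite (_ : (i.+1 < _)%N) //; lia.
by move=> i; rewrite mem_index_iota => hi /=; rewrite ifF //; lia.
Qed.

(** * Roots of unity and their distance from 1 *)

Lemma sum_unity_root (F : fieldType) (N : nat) (x : F) : x ^+ N = 1 ->
  \sum_(k < N) x ^+ k = if x == 1 then N%:R else 0.
Proof.
move=> xN; have [->|x1] := eqVneq x 1.
  by rewrite (eq_bigr (fun=> 1)) ?sumr_const ?card_ord // => i _; rewrite expr1n.
by apply: (mulfI (_ : x - 1 != 0)); rewrite ?subr_eq0 // -subrX1 xN subrr mulr0.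
Qed.

(** If [sin] dipped below the chord at [x], the mean value theorem on both sides of [x] would give
    [cos c1 < 2/pi < cos c2] with [c1 < c2], although [cos] decreases on [[0, pi]]. *)
Lemma sin_ge_chord (R : realType) (x : R) : 0 <= x <= pi / 2 -> 2 / pi * x <= sin x.
Proof.
move=> /andP[]; rewrite le_eqVlt => /predU1P[<-|x0]; first by rewrite mulr0 sin0.
rewrite le_eqVlt => /predU1P[->|xp].
  by rewrite sin_pihalf mulrA divfK ?gt_eqF ?pi_gt0 // mulfV // pnatr_eq0.
rewrite leNgt; apply/negP => lt.
pose g (y : R) := sin y - 2 / pi * y.
have dg (y : R) : is_derive y 1 g (cos y - 2 / pi).
  by apply: is_derive_eq; rewrite /GRing.scale /= mulr1.
have cg (a b : R) : {within `[a, b], continuous g}%classic.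
  apply: continuous_subspaceT => y.
  by apply: differentiable_continuous; apply/derivable1_diffP; apply: ex_derive.
have [c1 c1in e1] := MVT x0 (fun y _ => dg y) (cg _ _).
have [c2 c2in e2] := MVT xp (fun y _ => dg y) (cg _ _).
rewrite !in_itv /= in c1in c2in.
have p0 := pi_gt0 R.
have g0 : g 0 = 0 by rewrite /g sin0 mulr0 subrr.
have gp : g (pi / 2) = 0.
  by rewrite /g sin_pihalf mulrA divfK ?gt_eqF // mulfV ?subrr // pnatr_eq0.
have gx : g x < 0 by rewrite subr_lt0.
have : cos c2 < cos c1.
  by rewrite ltr_cos ?in_itv /=; lra.
have : cos c1 - 2 / pi < 0.
  by rewrite -(pmulr_llt0 _ (_ : 0 < x - 0)) -?e1 ?g0 ?subr0.
have : 0 < cos c2 - 2 / pi.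
  by rewrite -(pmulr_lgt0 _ (_ : 0 < pi / 2 - x)) -?e2 ?gp ?sub0r ?oppr_gt0 ?subr_gt0.
by lra.
Qed.

Local Open Scope complex_scope.
Definition cis (R : realType) (t : R) : R[i] := cos t +i* sin t.

Lemma cisX (R : realType) (t : R) n : cis t ^+ n = cis (n%:R * t).
Proof.
elim: n => [|n IH]; first by rewrite /cis mul0r cos0 sin0 expr0.
rewrite exprSr IH -natr1 mulrDl mul1r /cis cosD sinD; simpc.
by congr (_ +i* _); rewrite addrC.
Qed.

Lemma norm_1Bcis (R : realType) (t : R) : `|1 - cis t| = (2 * `|sin (t / 2)|)%:C.
Proof.
rewrite normc_def /=; congr (_%:C).
have -> : 2 * `|sin (t / 2)| = Num.sqrt ((2 * sin (t / 2)) ^+ 2).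
  by rewrite sqrtr_sqr normrM normr_nat.
congr Num.sqrt.
have {1 2}-> : t = t / 2 + t / 2 by field.
have := cos2Dsin2 (t / 2); rewrite cosD sinD.
move: (cos _) (sin _) => c s e.
rewrite sub0r.
transitivity (4 * s ^+ 2 * (c ^+ 2 + s ^+ 2)); last by rewrite e; ring.
by rewrite -[X in X - _]e; ring.
Qed.

(** For [om = e^(2 pi i/N)], [|1 - om^c| = 2 |sin (pi c/N)|]; the chord bound applies at [c] or, by
    the symmetry of [sin] about [pi/2], at [N - c]. *)
Lemma exists_root_of_unity (R : realType) (N : nat) : (0 < N)%N ->
  exists2 om : R[i], N.-primitive_root om &
    forall c, (c < N)%N -> (4 * (minn c (N - c))%:R / N%:R)%:C <= `|1 - om ^+ c|.
Proof.
move=> N0; have N0' : (0 : R) < N%:R by rewrite ltr0n.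
have p0 := pi_gt0 R.
pose om : R[i] := cis (pi *+ 2 / N%:R).
have bound c : (c < N)%N -> (4 * (minn c (N - c))%:R / N%:R)%:C <= `|1 - om ^+ c|.
  move=> cN; rewrite cisX norm_1Bcis lecR.
  have -> : c%:R * (pi *+ 2 / N%:R) / 2 = pi * (c%:R / N%:R) :> R.
    by rewrite -mulr_natr; field; rewrite gt_eqF.
  have key d : (d * 2 <= N)%N -> 2 * (d%:R / N%:R) <= sin (pi * (d%:R / N%:R)) :> R.
    move=> dN; have := @sin_ge_chord R (pi * (d%:R / N%:R)).
    rewrite [_ / _ * _]mulrA divfK ?gt_eqF //; apply.
    rewrite mulr_ge0 ?divr_ge0 ?(ltW p0) //= ler_pM2l // ler_pdivrMr //.
    by rewrite mulrC ler_pdivlMr // -natrM ler_nat.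
  have -> : 4 * (minn c (N - c))%:R / N%:R = 2 * (2 * ((minn c (N - c))%:R / N%:R)) :> R.
    ring.
  rewrite ler_pM2l //; have [le|lt] := leqP (c * 2) N.
    have -> : minn c (N - c) = c by lia.
    exact: le_trans (key _ le) (ler_norm _).
  have -> : minn c (N - c) = (N - c)%N by lia.
  have -> : pi * (c%:R / N%:R) = pi - pi * ((N - c)%N%:R / N%:R) :> R.
    by rewrite natrB ?(ltnW cN) //; field; rewrite gt_eqF.
  have -> y : sin (pi - y) = sin y :> R.
    by rewrite addrC sinDpi sinN opprK.
  apply: le_trans (key _ _) (ler_norm _); lia.
exists om => //.
have omN : om ^+ N = 1.
  rewrite cisX mulrC divfK ?gt_eqF // /cis.
  by rewrite cos2pi sin2pi.
(* The order [M] divides [N]. If [M < N], then [1 - om^M = 0] would contradict the positive lower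
   bound at [c = M]. *)
have [M prM MN] := prim_order_exists N0 omN.
suff <- : M = N by [].
apply/eqP; rewrite eqn_leq dvdn_leq //= leqNgt; apply/negP => lt.
have := bound _ lt; rewrite (prim_expr_order prM) subrr normr0.
have M0 := prim_order_gt0 prM.
rewrite -[0 in X in X -> _]/(0%:C) lecR leNgt => /negP; apply.
rewrite divr_gt0 // mulr_gt0 // ltr0n; lia.
Qed.

Lemma norm_unity_root (C : numDomainType) (N : nat) (x : C) : (0 < N)%N -> x ^+ N = 1 -> `|x| = 1.
Proof.
move=> N0 /(congr1 Num.norm); rewrite normrX normr1 => /eqP.
by rewrite pexpr_eq1 // => /eqP.
Qed.

Lemma expr_dvd1 (F : nzRingType) (N M : nat) (x : F) : x ^+ N = 1 -> (N %| M)%N -> x ^+ M = 1.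
Proof. by move=> xN /dvdnP[q ->]; rewrite mulnC exprM xN expr1n. Qed.

(** * Discrete Fourier analysis on [Z/N] *)

Section Fourier.
Variables (C : numFieldType) (N : nat) (om : C).
Hypothesis om_prim : N.-primitive_root om.
Let N0 : (0 < N)%N := prim_order_gt0 om_prim.
Let N0' : N%:R != 0 :> C. Proof. by rewrite pnatr_eq0 -lt0n. Qed.

(* Fourier coefficient at [c] of the indicator of [[0, t)] on [Z/N]. *)
Definition dftcoef (t c : nat) : C := N%:R^-1 * \sum_(d < t) om ^- (c * d).

(** Fourier inversion: after exchanging the sums, the sum over [c] is [N] at [d = a] and zero
    elsewhere. *)
Lemma dft_indicator (t a : nat) : (t <= N)%N -> (a < N)%N ->
  (a < t)%N%:R = \sum_(c < N) dftcoef t c * om ^+ (c * a).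
Proof.
move=> tN aN; have om0 : om != 0 by rewrite (prim_root_eq0 om_prim) -lt0n.
under eq_bigr => c _ do rewrite /dftcoef -mulrA mulr_suml.
rewrite -mulr_sumr exchange_big /=.
have E (d : 'I_t) : \sum_(c < N) om ^- (c * d) * om ^+ (c * a) = if a == d then N%:R else 0.
  under eq_bigr => c _ do rewrite mulrC !(mulnC c) !exprM -exprVn -exprMn.
  rewrite sum_unity_root.
    rewrite -[X in _ == X](mulfV (_ : om ^+ d != 0)) ?expf_neq0 //.
    rewrite (inj_eq (mulIf _)) ?invr_eq0 ?expf_neq0 // (eq_prim_root_expr om_prim).
    by rewrite !modn_small // (leq_trans _ tN).
  rewrite exprMn exprVn -!exprM !(mulnC _ N) !exprM (prim_expr_order om_prim).
  by rewrite !expr1n invr1 mulr1.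
rewrite (eq_bigr _ (fun d _ => E d)) -big_mkcond /=.
have [at_|ta] := ltnP a t.
  by rewrite (big_pred1 (Ordinal at_)) ?mulVf // => d; rewrite eq_sym.
by rewrite big_pred0 ?mulr0 // => d; apply/eqP => ad; have := ltn_ord d; lia.
Qed.

Lemma dftcoef0 t : dftcoef t 0 = t%:R / N%:R.
Proof.
rewrite /dftcoef mulrC (eq_bigr (fun=> 1)) ?sumr_const ?card_ord // => i _.
by rewrite mul0n expr0 invr1.
Qed.

(** The geometric sum with ratio [om^-c], multiplied by [om^-c - 1], has norm at most 2. The
    intended [r] is [minn c (N - c)], for which [exists_root_of_unity] supplies the hypothesis. *)
Lemma norm_dftcoef_le (t c : nat) (r : C) : (0 < c < N)%N -> 0 < r ->
  4 * r / N%:R <= `|1 - om ^+ c| -> `|dftcoef t c| <= r^-1 / 2.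
Proof.
move=> cN r0 hr.
have om0 : om != 0 by rewrite (prim_root_eq0 om_prim) -lt0n.
have n1 k : `|om ^+ k| = 1.
  by rewrite normrX (norm_unity_root N0 (prim_expr_order om_prim)) expr1n.
have NN : 0 < N%:R :> C by rewrite ltr0n.
have pos : 0 < `|1 - om ^+ c| by apply: lt_le_trans hr; rewrite divr_gt0 ?mulr_gt0.
rewrite /dftcoef normrM normfV normr_nat.
under eq_bigr => d _ do rewrite exprM -exprVn.
set S := \sum_(d < t) _.
have : `|1 - om ^+ c| * `|S| <= 2.
  have -> : `|1 - om ^+ c| = `|(om ^+ c)^-1 - 1|.
    transitivity (`|om ^+ c| * `|(om ^+ c)^-1 - 1|); last by rewrite n1 mul1r.
    by rewrite -normrM mulrBr mulr1 mulfV ?expf_neq0.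
  rewrite -normrM -subrX1 (le_trans (ler_normB _ _)) //.
  by rewrite normr1 normrX normfV n1 invr1 expr1n.
move=> hS.
have -> : r^-1 / 2 = N%:R^-1 * (2 / (4 * r / N%:R)).
  by field; rewrite N0' gt_eqF.
rewrite ler_pM2l ?invr_gt0 //.
rewrite ler_pdivlMr ?divr_gt0 ?mulr_gt0 // mulrC.
by apply: le_trans hS; rewrite ler_wpM2r.
Qed.

Section Multi.
Variables (s : nat) (z : 'I_s -> nat).

(** Orthogonality of characters: once the product is expanded over frequency vectors [h], the mean
    over [k] of [om^(k (h . z))] is 1 if [N] divides [h . z] and 0 otherwise. *)
Lemma fourier_average (F : 'I_s -> 'I_N -> C) :
  N%:R^-1 * \sum_(k < N) \prod_j \sum_c F j c * om ^+ (c * (k * z j)) =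
  \sum_(h : {ffun 'I_s -> 'I_N} | (N %| \sum_j h j * z j)%N) \prod_j F j (h j).
Proof.
under eq_bigr => k _ do rewrite bigA_distr_bigA /=.
rewrite exchange_big mulr_sumr [RHS]big_mkcond /=; apply: eq_bigr => h _.
have E (k : 'I_N) : \prod_j (F j (h j) * om ^+ (h j * (k * z j))) =
    \prod_j F j (h j) * (om ^+ (\sum_j h j * z j)) ^+ k.
  rewrite big_split /=; congr (_ * _).
  rewrite -exprM mulnC big_distrr /= (big_morph _ (exprD om) (expr0 om)).
  by apply: eq_bigr => j _; congr (_ ^+ _); lia.
rewrite (eq_bigr _ (fun k _ => E k)) -mulr_sumr sum_unity_root; last first.
  by rewrite -exprM mulnC exprM (prim_expr_order om_prim) expr1n.
rewrite (prim_order_dvd om_prim); case: ifP => _; last by rewrite !mulr0.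
by rewrite mulrCA mulVf // mulr1.
Qed.

(** A nonzero frequency vector has some nonzero coordinate; the halved bound there alone gives the
    factor 1/2, and [G] bounds the other coordinates. *)
Lemma fourier_deviation (F G : 'I_s -> 'I_N -> C) (h0 : {ffun 'I_s -> 'I_N}) :
  (forall j, h0 j = 0%N :> nat) ->
  (forall j c, `|F j c| <= G j c) ->
  (forall j (c : 'I_N), (0 < c)%N -> `|F j c| <= G j c / 2) ->
  `|N%:R^-1 * \sum_(k < N) \prod_j \sum_c F j c * om ^+ (c * (k * z j))
    - \prod_j F j (h0 j)| <=
  2^-1 * \sum_(h : {ffun 'I_s -> 'I_N} | (N %| \sum_j h j * z j)%N && (h != h0)) \prod_j G j (h j).
Proof.
move=> h00 FG FG2.
rewrite fourier_average (bigD1 h0) /=; last by rewrite big1 // => j _; rewrite h00.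
rewrite addrAC subrr add0r (le_trans (ler_norm_sum _ _ _)) // mulr_sumr.
apply: ler_sum => h /andP[_ hh0].
have [j hj] : exists j, (0 < h j)%N.
  apply/existsP; apply: contraNT hh0 => /existsPn h0'.
  by apply/eqP/ffunP => j; apply: ord_inj; rewrite h00; apply/eqP; rewrite -leqn0 leqNgt.
rewrite normr_prod (bigD1 j) //= [in leRHS](bigD1 j) //= mulrA mulrC.
rewrite [leRHS]mulrC; apply: ler_pM => //; first exact: prodr_ge0.
  by apply: ler_prod => i _; rewrite normr_ge0 /=.
by rewrite mulrC FG2.
Qed.
End Multi.
End Fourier.

(** The indicator of a full period is constant. This removes the nonzero frequencies in the
    coordinates outside [u]. *)
Lemma dftcoef_full (C : numFieldType) (N : nat) (om : C) (c : nat) :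
  N.-primitive_root om -> (0 < c < N)%N -> dftcoef N om N c = 0.
Proof.
move=> om_prim /andP[c0 cN]; rewrite /dftcoef.
under eq_bigr => d _ do rewrite exprM -exprVn.
rewrite sum_unity_root; last first.
  by rewrite exprVn -exprM mulnC exprM (prim_expr_order om_prim) expr1n invr1.
by rewrite invr_eq1 -(prim_order_dvd om_prim) gtnNdvd // mulr0.
Qed.

(** * Discrepancy of a fixed lattice point set *)

(** With tail products [A], [B], [D], the difference is at most [(B - A) + d i * A = (1 - d i) * (B
    - A) + d i * B]. Induction and [B <= 1] bound this by [1 - (1 - d i) * D]. *)
Lemma prod_sub_le (R : realDomainType) (I : Type) (r : seq I) (a b d : I -> R) :
  (forall i, 0 <= a i <= b i) -> (forall i, b i <= 1) ->
  (forall i, b i <= a i + d i) -> (forall i, d i <= 1) ->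
  \prod_(i <- r) b i - \prod_(i <- r) a i <= 1 - \prod_(i <- r) (1 - d i).
Proof.
move=> hab b1 bd d1.
elim: r => [|i r IH]; first by rewrite !big_nil !subrr.
rewrite !big_cons.
have /andP[a0 ab] := hab i; have bi1 := b1 i; have bdi := bd i; have di1 := d1 i.
have : 0 <= \prod_(j <- r) a j <= \prod_(j <- r) b j.
  by rewrite prodr_ge0 ?ler_prod // => j _; case/andP: (hab j).
have : \prod_(j <- r) b j <= 1.
  apply: prodr_ile1 => j _; case/andP: (hab j) => ? ?.
  by rewrite b1 andbT (le_trans _ (_ : a j <= b j)).
move: IH; set A := \prod_(j <- r) a j; set B := \prod_(j <- r) b j; set D := \prod_(j <- r) _.
move=> IH B1 /andP[A0 AB].
have di0 : 0 <= d i by lra.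
have -> : b i * B - a i * A = b i * (B - A) + (b i - a i) * A by ring.
have h1 : b i * (B - A) <= B - A by rewrite ler_piMl // subr_ge0.
have h2 : (b i - a i) * A <= d i * A by rewrite ler_wpM2r // lerBlDr addrC.
have h3 : d i * B <= d i by rewrite ler_piMr.
have h4 : (1 - d i) * (B - A) <= (1 - d i) * (1 - D) by rewrite ler_wpM2l // subr_ge0.
nra.
Qed.

Section Discrepancy.
Variables (R : realType) (N s : nat) (gamma : nat -> R).
Hypothesis N0 : (0 < N)%N.
Hypothesis gamma_ge0 : forall j, 0 <= gamma j.

(** The value [1 + g] at frequency 0 dominates both [g], wanted for coordinates in [u], and [1],
    wanted outside, so one weight serves every [u]. *)
Definition weight (g : R) (c : nat) : R :=
  if c == 0%N then 1 + g else g * rho R N c.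

(* Sum over the whole dual lattice: the frequency [h = 0] contributes the product of
   the [1 + gamma j]. *)
Definition latsum (z : 'I_s -> nat) : R :=
  \sum_(h : {ffun 'I_s -> 'I_N} | (N %| \sum_j h j * z j)%N)
    \prod_(j < s) weight (gamma j) (h j).

Lemma weight_ge0 g c : 0 <= g -> 0 <= weight g c.
Proof.
by move=> g0; rewrite /weight; case: ifP => _; rewrite ?addr_ge0 ?mulr_ge0 ?rho_ge0.
Qed.

Lemma sum_weight g (P : pred nat) : P 0%N ->
  \sum_(c < N | P c) weight g c = 1 + g + g * \sum_(c < N | P c) rho R N c.
Proof.
move=> P0; rewrite (bigD1 (Ordinal N0)) //= mulr_sumr.
rewrite [in RHS](bigD1 (Ordinal N0)) //= rho0 mulr0 add0r; congr (_ + _).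
apply: eq_bigr => c /andP[_ c0]; rewrite /weight ifF //.
by apply: contra_neqF c0 => /eqP e; apply: ord_inj.
Qed.

Variable z : 'I_s -> nat.

(** An instance of [fourier_deviation]: the mean over [k] is the weighted count, the zero frequency
    is the weighted volume, and the other dual vectors form the right-hand side. *)
Lemma grid_discr_le (u : {set 'I_s}) (t : 'I_s -> nat) :
  (forall j, t j <= N)%N -> (forall j, j \notin u -> t j = N) ->
  gammaU gamma u *
    `|#|[set k : 'I_N | [forall j, (k * z j) %% N < t j]%N]|%:R / N%:R
      - \prod_j ((t j)%:R / N%:R)|
  <= 2^-1 * (latsum z - \prod_(j < s) (1 + gamma j)).
Proof.
move=> tN tu.
have [om om_prim om_far] := exists_root_of_unity R N0.
have N0' : (0 : R) < N%:R by rewrite ltr0n.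
(* [gammaU gamma u] is spread over the coordinates as a product of all the [g j]. *)
pose g j : R := if j \in u then gamma j else 1.
have g0 (j : 'I_s) : 0 <= g j by rewrite /g; case: ifP.
pose F j (c : 'I_N) : R[i] := (g j)%:C * dftcoef N om (t j) c.
pose G (j : 'I_s) (c : 'I_N) : R[i] := (weight (gamma j) c)%:C.
pose h0 : {ffun 'I_s -> 'I_N} := [ffun=> Ordinal N0].
have h00 j : h0 j = 0%N :> nat by rewrite ffunE.
have F0 j (c : 'I_N) : c = 0%N :> nat -> F j c = (g j * ((t j)%:R / N%:R))%:C.
  by move=> c0; rewrite /F c0 dftcoef0 !(rmorphM, fmorphV, rmorph_nat).
have FG2 j (c : 'I_N) : (0 < c)%N -> `|F j c| <= G j c / 2.
  move=> c0; have cN : (0 < c < N)%N by rewrite c0 ltn_ord.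
  have Ge0 : 0 <= G j c / 2 by rewrite divr_ge0 // (lecR 0) weight_ge0.
  rewrite /F normrM; case: (boolP (j \in u)) => ju; last first.
    by rewrite tu // dftcoef_full // normr0 mulr0.
  rewrite /G /weight gtn_eqF // rmorphM -mulrA /g ju ger0_norm ?(lecR 0) //.
  rewrite ler_wpM2l ?(lecR 0) // /rho fmorphV rmorph_nat.
  apply: (norm_dftcoef_le om_prim) => //; first by rewrite ltr0n; lia.
  by have := om_far _ (ltn_ord c); rewrite !(rmorphM, fmorphV, rmorph_nat).
have FG j c : `|F j c| <= G j c.
  case: (posnP c) => [c0|/FG2 le]; last first.
    apply: le_trans (le _) _; rewrite ler_pdivrMr // ler_peMr ?ler1n //.
    by rewrite (lecR 0) weight_ge0.
  have Fge0 : 0 <= g j * ((t j)%:R / N%:R) by rewrite mulr_ge0 ?divr_ge0.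
  rewrite F0 // ger0_norm ?(lecR 0) //.
  rewrite /G lecR /weight c0 eqxx.
  apply: (@le_trans _ _ (g j)).
    by rewrite ler_piMr // ler_pdivrMr // mul1r ler_nat.
  by rewrite /g; case: ifP => _; rewrite ?lerDr ?lerDl.
have := fourier_deviation om_prim z h00 FG FG2.
have produ (x : 'I_s -> R) : \prod_j (g j * x j) = gammaU gamma u * \prod_j x j.
  by rewrite big_split /= /gammaU [in RHS]big_mkcond.
have -> : \prod_j F j (h0 j) = (gammaU gamma u * \prod_j ((t j)%:R / N%:R))%:C.
  rewrite -produ rmorph_prod; apply: eq_bigr => j _.
  by rewrite F0.
have -> : N%:R^-1 * \sum_(k < N) \prod_j \sum_c F j c * om ^+ (c * (k * z j)) =
  (gammaU gamma u * (#|[set k : 'I_N | [forall j, (k * z j) %% N < t j]%N]|%:R / N%:R))%:C.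
  have E (k : 'I_N) : \prod_j \sum_c F j c * om ^+ (c * (k * z j)) =
      (gammaU gamma u)%:C * (k \in [set k : 'I_N | [forall j, (k * z j) %% N < t j]%N])%:R.
    transitivity (\prod_j (g j * ((k * z j) %% N < t j)%N%:R))%:C.
      rewrite rmorph_prod; apply: eq_bigr => j _.
      rewrite rmorphM rmorph_nat (dft_indicator om_prim) ?ltn_mod // mulr_sumr.
      apply: eq_bigr => c _; rewrite /F -mulrA; congr (_ * (_ * _)).
      by rewrite mulnC exprM -(prim_expr_mod om_prim (k * z j)) -exprM mulnC.
    rewrite produ rmorphM; congr (_ * _); rewrite inE rmorph_prod.
    case: forallP => [all|nall].
      by rewrite big1 // => j _; rewrite all rmorph1.
    have [j /negbTE nj] : exists j, ~~ ((k * z j) %% N < t j)%N.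
      by apply/existsP; rewrite -negb_forall; apply/negP => /forallP.
    by rewrite (bigD1 j) //= nj rmorph0 mul0r.
  rewrite (eq_bigr _ (fun k _ => E k)) -mulr_sumr.
  rewrite rmorphM rmorphM fmorphV !rmorph_nat mulrCA; congr (_ * _).
  rewrite mulrC; congr (_ * _); rewrite -natr_sum -sum1_card [in RHS]big_mkcond /=.
  by congr _%:R; apply: eq_bigr => k _; case: ifP.
have -> : \sum_(h : {ffun 'I_s -> 'I_N} | (N %| \sum_j h j * z j)%N && (h != h0))
      \prod_j G j (h j) = (latsum z - \prod_(j < s) (1 + gamma j))%:C.
  rewrite /latsum [in RHS](bigD1 h0) /=; last by rewrite big1 // => j _; rewrite h00.
  have -> : \prod_(j < s) weight (gamma j) (h0 j) = \prod_(j < s) (1 + gamma j).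
    by apply: eq_bigr => j _; rewrite h00.
  by rewrite addrAC subrr add0r rmorph_sum; apply: eq_bigr => h _; rewrite rmorph_prod.
rewrite -rmorphB -mulrBr normc_def /= expr0n addr0 sqrtr_sqr normrM.
rewrite -(rmorph_nat (real_complex R)) -fmorphV -rmorphM lecR ger0_norm //.
by apply: prodr_ge0.
Qed.

(** Here [t] is the ceiling of [y]: no integer lies in [[y, t)], so rounding up leaves the count of
    points unchanged. *)
Lemma exists_ceil (y : R) : 0 <= y <= N%:R ->
  exists2 t : nat, (t <= N)%N & (y <= t%:R <= y + 1) /\ (forall a : nat, (a%:R < y) = (a < t)%N).
Proof.
move=> /andP[y0 yN].
have ex : exists n : nat, y <= n%:R by exists N.
have [t yt mint] := ex_minnP ex; exists t; first exact: mint.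
split.
  rewrite yt /=; case: t yt mint => [|t] yt mint; first by rewrite addr_ge0.
  rewrite -natr1 lerD2r leNgt; apply/negP => /ltW /mint; by rewrite ltnn.
move=> a; apply/idP/idP => [ay|at_]; first by rewrite -(ltr_nat R) (lt_le_trans ay).
by rewrite ltNge; apply/negP => /mint; rewrite leqNgt at_.
Qed.

(** Rounding each [N * y j] up changes only the volume. A coordinate in [u] moves by at most [1/N],
    and one outside is already on the grid, so [prod_sub_le] applies. *)
Lemma discr_le (u : {set 'I_s}) (x : 'I_s -> R) : (forall j, 0 < x j <= 1) ->
  gammaU gamma u * `|discr N z (restr u x)| <=
    gammaU gamma u * (1 - (1 - N%:R^-1) ^+ #|u|)
    + 2^-1 * (latsum z - \prod_(j < s) (1 + gamma j)).
Proof.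
move=> hx; have N0' : (0 : R) < N%:R by rewrite ltr0n.
pose y := restr u x.
have hy j : 0 <= y j <= 1.
  by rewrite /y /restr; case: ifP => _; rewrite ?ler01 ?lexx //; have /andP[/ltW-> ->] := hx j.
have yN j : 0 <= N%:R * y j <= N%:R.
  by have /andP[y0 y1] := hy j; rewrite mulr_ge0 //= ler_piMr.
pose P j t := (t <= N)%N /\ (N%:R * y j <= t%:R <= N%:R * y j + 1) /\
  (forall a : nat, (a%:R < N%:R * y j) = (a < t)%N).
have /choice[t tP] : forall j, exists t, P j t.
  by move=> j; have [t ? [? ?]] := exists_ceil (yN j); exists t.
have tN j : (t j <= N)%N by case: (tP j).
have tu j : j \notin u -> t j = N.
  move=> /negbTE ju; apply/eqP; rewrite eqn_leq tN /=.
  have [_ [/andP[+ _] _]] := tP j.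
  by rewrite /y /restr ju mulr1 ler_nat.
have gU0 : 0 <= gammaU gamma u by apply: prodr_ge0.
have := grid_discr_le tN tu.
have -> : [set k : 'I_N | [forall j, (k * z j) %% N < t j]%N] =
          [set k : 'I_N | [forall j, lat_pt R N z k j < y j]].
  apply/setP => k; rewrite !inE; apply: eq_forallb => j.
  by rewrite -(proj2 (proj2 (tP j))) /lat_pt ltr_pdivrMr // mulrC.
move=> grid; rewrite /discr -/y.
have -> : #|[set k : 'I_N | [forall j, lat_pt R N z k j < y j]]%classic| =
          #|[set k : 'I_N | [forall j, lat_pt R N z k j < y j]]|.
  by apply: eq_card => k; apply/idP/idP; rewrite !inE.
set c := _ / N%:R in grid *.
set T := \prod_j _ in grid; set Y := \prod_(j < s) y j.
have TY : T - Y <= 1 - (1 - N%:R^-1) ^+ #|u|.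
  have -> : (1 - N%:R^-1) ^+ #|u| = \prod_(j < s) (1 - if j \in u then N%:R^-1 else 0) :> R.
    rewrite -prodr_const big_mkcond; apply: eq_bigr => j _; case: ifP => //.
    by rewrite subr0.
  apply: prod_sub_le => j.
  - have [_ [/andP[lo _] _]] := tP j; have /andP[-> _] := hy j.
    by rewrite ler_pdivlMr // mulrC.
  - by rewrite ler_pdivrMr // mul1r ler_nat.
  - case: ifPn => ju.
      have [_ [/andP[_ hi] _]] := tP j.
      by rewrite ler_pdivrMr // mulrDl mulVf ?gt_eqF // [y j * _]mulrC.
    by rewrite tu // mulfV ?gt_eqF // /y /restr (negbTE ju) addr0.
  - by case: ifP => _ //; rewrite invf_le1 // ler1n.
have YT : 0 <= T - Y.
  rewrite subr_ge0; apply: ler_prod => j _; have [_ [/andP[lo _] _]] := tP j.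
  by have /andP[-> _] := hy j; rewrite ler_pdivlMr // mulrC.
rewrite [leRHS]addrC; apply: le_trans (lerD grid (ler_wpM2l gU0 TY)).
rewrite -mulrDr ler_wpM2l //.
have -> : c - Y = (c - T) + (T - Y) by ring.
by rewrite (le_trans (ler_normD _ _)) // (ger0_norm YT).
Qed.

(** Each pair [(x, u)] is covered by the term of [u] in the sum, the other terms being
    nonnegative. *)
Lemma Dstar_le :
  Dstar N gamma z <=
    \sum_(u : {set 'I_s}) gammaU gamma u * (1 - (1 - N%:R^-1) ^+ #|u|)
    + 2^-1 * (latsum z - \prod_(j < s) (1 + gamma j)).
Proof.
set A := \sum_u _; set V := _ - _.
have term_ge0 (u : {set 'I_s}) : 0 <= gammaU gamma u * (1 - (1 - N%:R^-1) ^+ #|u|).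
  rewrite mulr_ge0 ?prodr_ge0 // subr_ge0 exprn_ile1 ?subr_ge0 ?lerBlDr ?lerDl ?invr_ge0 //.
  by rewrite invf_le1 ?ltr0n // ler1n.
(* The empty [u] with all sides equal to [N] bounds a nonnegative quantity by [V / 2]. *)
have V0 : 0 <= 2^-1 * V.
  apply: le_trans (grid_discr_le (u := finset.set0) (t := fun=> N) _ _) => //.
  by rewrite mulr_ge0 ?prodr_ge0.
have ub r : (exists x : 'I_s -> R, (forall j, 0 < x j <= 1) /\
    exists u : {set 'I_s}, (0 < #|u|)%N /\
      r = gammaU gamma u * `|discr N z (restr u x)|) -> r <= A + 2^-1 * V.
  move=> [x [hx [u [_ ->]]]]; apply: le_trans (discr_le u hx) _.
  by rewrite lerD2r /A (bigD1 u) //= lerDl sumr_ge0.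
rewrite /Dstar; set E := [set r | _]%classic.
(* For [s = 0] there is no nonempty [u], and the supremum of the empty set is 0. *)
have [->|/set0P ne] := eqVneq E set0%classic; first by rewrite sup0 addr_ge0 ?sumr_ge0.
exact: ge_sup.
Qed.
End Discrepancy.

(** * Averaging over the admissible generating vectors *)

Section Average.
Variables (R : realType) (b m : nat).
Hypothesis b_prime : prime b.
Hypothesis m0 : (0 < m)%N.
Let N := (b ^ m)%N.
Let b0 : (0 < b)%N := prime_gt0 b_prime.
Let b1 : (1 < b)%N := prime_gt1 b_prime.
Let N0 : (0 < N)%N. Proof. by rewrite expn_gt0 b0. Qed.
Let N1 : (1 < N)%N. Proof. by rewrite -(expn0 b) ltn_exp2l. Qed.

(** Counting inside ['I_N] loses nothing: admissible values are below [N], including the value 1, as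
    [1 < N]. *)
Definition cardZ (w : nat) : nat := #|[set x : 'I_N | inZ b m w x]|.

Lemma cardZ_gt0 w : (0 < cardZ w)%N.
Proof.
rewrite card_gt0; apply/set0Pn; exists (Ordinal N1); rewrite inE /inZ.
case: ltnP => //= wm; rewrite coprime1n andbT subn_gt0 -(expn0 b) ltn_exp2l // subn_gt0 //.
Qed.

(** Coprimality to [b^m] means not being a multiple of [b], so the multiples are subtracted; [x = 0]
    cancels among them. *)
Lemma sum_inZ (V : zmodType) w (F : nat -> V) : (w < m)%N ->
  \sum_(x < N | inZ b m w x) F x =
    \sum_(x < b ^ (m - w)) F x - \sum_(x < b ^ (m - w).-1) F (b * x)%N.
Proof.
move=> wm; have mw : (m - w = (m - w).-1.+1)%N by lia.
have r0 : (0 < b ^ (m - w))%N by rewrite expn_gt0 b0.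
rewrite -big_dvd // -expnS -mw.
rewrite [X in _ = X - _](bigID (fun x : 'I__ => b %| x)%N) /= addrAC subrr add0r.
rewrite (big_ord_widen_cond N (fun x => ~~ (b %| x)%N) F); last first.
  by rewrite leq_exp2l // leq_subr.
apply: eq_bigl => x; rewrite /inZ wm (coprime_sym x) coprime_pexpl // prime_coprime //.
case: (boolP (b %| x)%N) => bx; rewrite ?andbF //= andbT.
have : (0 < x)%N by case: posnP bx => // ->; rewrite dvdn0.
by lia.
Qed.

Variable om : R[i].
Hypothesis om_prim : N.-primitive_root om.

(* With [n = k b^w] and [gcd(n, N) = b^i], the inner character sum is a Ramanujan sum;
   what is left to bound is [S_(b^(i+1)) - S_(b^i)], between [0] and [2(b - 1)]. *)
Lemma sum_character (g : R) (w k : nat) : 0 <= g <= 1 ->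
  exists2 e : R,
    \sum_(x < N | inZ b m w x)
      \sum_(c < N) (weight N g c)%:C * om ^+ (c * (k * (b ^ w * x))) = e%:C &
    0 <= e <= (cardZ w)%:R *
      (if (N %| k * b ^ w)%N then 1 + g + g * harm R N else 1 + g).
Proof.
move=> /andP[g0 g1].
have sumW (P : pred nat) : P 0%N -> _ := sum_weight N0 g (P := P).
have cardE : (cardZ w)%:R = \sum_(x < N | inZ b m w x) (1 : R).
  by rewrite sumr_const /cardZ cardsE.
case: ifPn => [dv|ndv].
  exists ((cardZ w)%:R * (1 + g + g * harm R N)).
    have E (x : 'I_N) : \sum_(c < N) (weight N g c)%:C * om ^+ (c * (k * (b ^ w * x))) =
        (1 + g + g * harm R N)%:C.
      rewrite /harm -(sumW xpredT) // rmorph_sum; apply: eq_bigr => c _.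
      rewrite (expr_dvd1 (prim_expr_order om_prim)) ?mulr1 //.
      have -> : (c * (k * (b ^ w * x)) = k * b ^ w * (c * x))%N by lia.
      exact: dvdn_mulr.
    rewrite (eq_bigr _ (fun x _ => E x)) cardE mulr_suml rmorph_sum.
    by apply: eq_bigr => x _; rewrite mul1r.
  rewrite lexx andbT mulr_ge0 // !addr_ge0 // mulr_ge0 // /harm sumr_ge0 // => c _.
  exact: rho_ge0.
have wm : (w < m)%N.
  by rewrite ltnNge; apply: contra ndv => mw; rewrite dvdn_mull // dvdn_exp2l.
set n := (k * b ^ w)%N in ndv *.
have /(dvdn_pfactor _ _ b_prime)[i im gE] := dvdn_gcdr n N.
have {}im : (i < m)%N.
  rewrite ltn_neqAle im andbT; apply: contra ndv => /eqP e.
  by rewrite -[X in (X %| _)%N]/(b ^ m)%N -e -gE dvdn_gcdl.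
(* With [M = gcd(n, N)], one has [b * b^q = N/M] and [b^q = N/(b M)]: these are the moduli of the
   two divisibility conditions on [c]. *)
pose q := (m - i).-1; pose M := (b ^ i)%N.
have M0 : (0 < M)%N by rewrite expn_gt0 b0.
have q0 : (0 < b ^ q)%N by rewrite expn_gt0 b0.
have NE : N = (M * (b * b ^ q))%N by rewrite -expnS -expnD; congr (b ^ _)%N; rewrite /q; lia.
have [n' nE co] : exists2 n', n = (M * n')%N & coprime (b * b ^ q) n'.
  have /dvdnP[n' nE] : (M %| n)%N by rewrite /M -gE dvdn_gcdl.
  exists n'; first by rewrite mulnC.
  move: gE; rewrite NE nE mulnC -muln_gcdr -/M => /eqP.
  by rewrite -[X in _ == X]muln1 eqn_pmul2l // gcdnC.
have dv1 c : (N %| c * n)%N = (b * b ^ q %| c)%N.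
  by rewrite nE mulnCA NE dvdn_pmul2l // Gauss_dvdl.
have dv2 c : (N %| c * n * b)%N = (b ^ q %| c)%N.
  by rewrite mulnAC dv1 (mulnC c) dvdn_pmul2l.
pose r' := (b ^ (m - w).-1)%N.
have rE : (b ^ (m - w) = b * r')%N by rewrite -expnS; congr (b ^ _)%N; lia.
have cardE' : (cardZ w)%:R = r'%:R * (b%:R - 1) :> R.
  rewrite cardE (sum_inZ (fun=> 1)) // !sumr_const !card_ord rE natrM; ring.
have r'0 : (0 : R) < r'%:R by rewrite ltr0n expn_gt0 b0.
have d0 : (0 : R) < (b ^ q)%:R by rewrite ltr0n.
have bR0 : (0 : R) < b%:R by rewrite ltr0n.
have NE2 : N = (b ^ q * (b * M))%N by rewrite NE mulnA mulnC (mulnC b).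
have NE3 : N = (b * b ^ q * M)%N by rewrite NE mulnC.
(* By [sum_rho_dvd], the multiples of [b * b^q] contribute [harm R M] and those of [b^q] contribute
   [harm R (b * M)], each divided by its modulus. *)
exists (r'%:R * (b%:R - 1) * (1 + g)
        + g * (r'%:R / (b ^ q)%:R) * (harm R M - harm R (b * M))).
  rewrite exchange_big /=.
  have E (c : 'I_N) :
    \sum_(x < N | inZ b m w x) (weight N g c)%:C * om ^+ (c * (k * (b ^ w * x))) =
    (weight N g c * (if (b * b ^ q %| c)%N then (b * r')%:R else 0)
     - weight N g c * (if (b ^ q %| c)%N then r'%:R else 0))%:C.
    rewrite (sum_inZ (fun x => (weight N g c)%:C * om ^+ (c * (k * (b ^ w * x))))) //.
    rewrite -!mulr_sumr -mulrBr -mulrBr rmorphM rmorphB; congr (_ * _).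
    have omX y : om ^+ (c * (k * (b ^ w * y))) = (om ^+ (c * n)) ^+ y.
      by rewrite -exprM /n !mulnA.
    have omN y : (N %| y)%N -> om ^+ y = 1.
      exact: expr_dvd1 (prim_expr_order om_prim).
    (* As [n * b^(m-w) = k * b^m], both geometric sums run over full periods. *)
    have nr : (N %| n * (b * r'))%N.
      rewrite -rE /n -mulnA -expnD subnKC ?(ltnW wm) //; exact: dvdn_mull.
    congr (_ - _).
      under eq_bigr => x _ do rewrite omX.
      rewrite rE sum_unity_root.
        by rewrite -(prim_order_dvd om_prim) dv1; case: ifP => _; rewrite ?rmorph_nat ?rmorph0.
      by rewrite -exprM omN // -mulnA dvdn_mull.
    have omX' y : om ^+ (c * (k * (b ^ w * (b * y)))) = (om ^+ (c * n * b)) ^+ y.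
      by rewrite omX !exprM.
    under eq_bigr => x _ do rewrite omX'.
    rewrite sum_unity_root.
      by rewrite -(prim_order_dvd om_prim) dv2; case: ifP => _; rewrite ?rmorph_nat ?rmorph0.
    by rewrite -exprM omN // -(mulnA (c * n)%N) -mulnA dvdn_mull.
  rewrite (eq_bigr _ (fun c _ => E c)) -rmorph_sum sumrB; congr (_%:C).
  have pull (P : pred nat) (a : R) :
      \sum_(c < N) weight N g c * (if P c then a else 0) = a * \sum_(c < N | P c) weight N g c.
    rewrite mulr_sumr [RHS]big_mkcond; apply: eq_bigr => c _.
    by case: ifP; rewrite ?mulr0 // mulrC.
  rewrite (pull (fun c => b * b ^ q %| c)%N) (pull (fun c => b ^ q %| c)%N).
  rewrite (sumW (fun c => b * b ^ q %| c)%N) // (sumW (fun c => b ^ q %| c)%N) //.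
  rewrite (sum_rho_dvd R _ NE3) ?muln_gt0 ?b0 // (sum_rho_dvd R _ NE2) // !natrM.
  by field; rewrite !gt_eqF.
rewrite cardE'.
have hle : harm R M <= harm R (b * M) by apply: harm_le => //; rewrite leq_pmull.
have hge : harm R (b * M) - harm R M <= 2 * (b%:R - 1).
  apply: le_trans (harm_sub_le R M0 (leq_pmull _ b0)) _.
  rewrite ler_pdivrMr ?ltr0n // natrB ?leq_pmull // natrM le_eqVlt.
  by apply/orP; left; apply/eqP; ring.
set D := harm R (b * M) - harm R M in hge.
have D0 : 0 <= D by rewrite subr_ge0.
have -> : harm R M - harm R (b * M) = - D by rewrite opprB.
set t := r'%:R / _.
have t0 : 0 <= t by rewrite divr_ge0.
have tr : t <= r'%:R by rewrite ler_pdivrMr // ler_peMr ?ler1n // ltW.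
have bR1 : 0 <= b%:R - 1 :> R by rewrite subr_ge0 ler1n.
have h1 : 0 <= g * t * D by rewrite mulr_ge0 // mulr_ge0.
have h2 : g * t * D <= g * r'%:R * (2 * (b%:R - 1)).
  by apply: ler_pM => //; [exact: mulr_ge0 | exact: ler_wpM2l].
(* [g <= 1] enters here: at most [2 g r' (b - 1)] is lost from [(1 + g) r' (b - 1)], leaving at
   least [(1 - g) r' (b - 1)]. *)
have h3 : 0 <= (1 - g) * (r'%:R * (b%:R - 1)).
  by rewrite mulr_ge0 ?mulr_ge0 ?bR1 ?subr_ge0.
apply/andP; split; nra.
Qed.
End Average.

(** * Grouping by valuation and choice of the vector *)

(** Induction on [m]: dividing a nonzero multiple of [b] by [b] lowers its valuation by one, while
    the non-multiples have valuation 0. The index [k = 0], of infinite valuation, carries [T]. *)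
Lemma sum_by_logn (R : pzRingType) (b m : nat) (T : R) (U : nat -> R) : prime b ->
  \sum_(k < b ^ m) (if k == 0%N :> nat then T else U (logn b k)) =
  T + \sum_(p < m) (b ^ (m - p - 1) * (b - 1))%N%:R * U p.
Proof.
move=> b_prime; have b0 := prime_gt0 b_prime.
elim: m U => [|m IH] U; first by rewrite expn0 big_ord1 big_ord0 addr0.
rewrite expnS (bigID (fun k : 'I__ => b %| k)%N) /=.
rewrite (big_dvd _ (fun k => if k == 0%N then T else U (logn b k)) b0).
have -> : \sum_(k < b ^ m) (if b * k == 0 then T else U (logn b (b * k)))%N =
    \sum_(k < b ^ m) (if k == 0%N :> nat then T else U (logn b k).+1).
  apply: eq_bigr => k _; rewrite muln_eq0 (gtn_eqF b0) /=.
  case: eqVneq => // k0.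
  by rewrite (lognM _ b0) ?lt0n // logn_prime // eqxx.
have := IH (fun p => U p.+1); rewrite /= => ->.
rewrite -addrA big_ord_recl /= [X in _ + X = _]addrC; congr (_ + (_ + _)).
have E (k : 'I_(b * b ^ m)) : ~~ (b %| k)%N ->
    (if k == 0%N :> nat then T else U (logn b k)) = U 0%N.
  move=> bk; rewrite ifF; last by apply/eqP => k0; rewrite k0 dvdn0 in bk.
  by congr U; apply/eqP; rewrite -leqn0 leqNgt logn_gt0 mem_primes b_prime (negbTE bk) !andbF.
rewrite (eq_bigr _ E) sumr_const mulr_natl; congr (_ *+ _).
(* The non-multiples are counted as all [b * b^m] residues less the [b^m] multiples. *)
have := sum1_card 'I_(b * b ^ m); rewrite card_ord (bigID (fun k : 'I__ => b %| k)%N) /=.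
rewrite (@big_dvd nat b (b ^ m) (fun=> 1%N) b0) sum1_card card_ord sum1_card => /esym e.
have -> : (m.+1 - 0 - 1 = m)%N by lia.
by rewrite mulnBr muln1 (mulnC _ b) [in RHS]e addKn.
Qed.

Theorem theorem1 (R : realType) (b m : nat) (gamma : nat -> R) (w : nat -> nat) (s : nat)
  (hb : prime b) (hm : (5 <= m)%N)
  (hgpos : forall j, 0 < gamma j) (hgle1 : forall j, gamma j <= 1)
  (hgmon : forall i j, (i <= j)%N -> gamma j <= gamma i)
  (hwmon : forall i j, (i <= j)%N -> (w i <= w j)%N) :
  let N := (b ^ m)%N in
  let beta := fun j : nat => 1 + gamma j in
  exists z : 'I_s -> nat,
    (forall j : 'I_s, inZ b m (w j) (z j)) /\
    Dstar N gamma (fun j => (b ^ w j * z j)%N) <=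
      \sum_(u : {set 'I_s}) gammaU gamma u * (1 - (1 - N%:R^-1) ^+ #|u|)
      + 2^-1 * ( N%:R^-1 * \prod_(j < s) (beta j + gamma j * (S_N R N))
               + N%:R^-1 * \sum_(p < m)
                   ((b ^ (m - p - 1) * (b - 1))%N%:R
                    * (\prod_(j < s | (m - p <= w j)%N) (beta j + gamma j * (S_N R N)))
                    * (\prod_(j < s | (w j < m - p)%N) beta j))
               - \prod_(j < s) beta j).
Proof.
move=> N beta.
have m0 : (0 < m)%N by apply: leq_trans hm.
have b0 := prime_gt0 hb.
have N0 : (0 < N)%N by rewrite expn_gt0 b0.
have g01 j : 0 <= gamma j <= 1 by rewrite ltW //=.
have N0' : (0 : R) < N%:R by rewrite ltr0n.
have [om om_prim _] := exists_root_of_unity R N0.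
pose S := harm R N.
pose bd (k : nat) (j : 'I_s) : R := if (N %| k * b ^ w j)%N then beta j + gamma j * S else beta j.
pose Q (j : 'I_s) : pred 'I_N := fun x => inZ b m (w j) x.
pose zz (f : {ffun 'I_s -> 'I_N}) (j : 'I_s) : nat := (b ^ w j * f j)%N.
pose B : R := N%:R^-1 * \sum_(k < N) \prod_j bd k j.
have average : \sum_(f in family Q) latsum N gamma (zz f) <=
    (\prod_(j < s) (cardZ b m (w j))%:R) * B.
  pose chr (k : nat) (j : 'I_s) (x : nat) : R[i] :=
    \sum_(c < N) (weight N (gamma j) c)%:C * om ^+ (c * (k * (b ^ w j * x))).
  have ech k j := sum_character hb m0 om_prim (w j) k (g01 j).
  (* [sum_character] makes these sums real, so the real part is the sum itself. *)
  pose e (k : 'I_N) (j : 'I_s) : R := complex.Re (\sum_(x < N | inZ b m (w j) x) chr k j x).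
  have -> : \sum_(f in family Q) latsum N gamma (zz f) = N%:R^-1 * \sum_(k < N) \prod_j e k j.
    apply: (fmorph_inj (real_complex R)).
    rewrite rmorph_sum rmorphM fmorphV rmorph_nat rmorph_sum.
    have E (f : {ffun 'I_s -> 'I_N}) : (latsum N gamma (zz f))%:C =
        N%:R^-1 * \sum_(k < N) \prod_j chr k j (f j).
      rewrite rmorph_sum (fourier_average om_prim (zz f) (fun j c => (weight N (gamma j) c)%:C)).
      by apply: eq_bigr => h _; rewrite rmorph_prod.
    rewrite (eq_bigr _ (fun f _ => E f)) -mulr_sumr exchange_big /=; congr (_ * _).
    (* The admissible vectors form a product set, so summing over them factors through the
       coordinates. *)
    apply: eq_bigr => k _; rewrite -(bigA_distr_big_dep _ (fun j (x : 'I_N) => chr k j x)).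
    rewrite rmorph_prod; apply: eq_bigr => j _; rewrite /e.
    by have [y -> _] := ech k j.
  rewrite /B mulrCA ler_pM2l ?invr_gt0 // mulr_sumr; apply: ler_sum => k _.
  rewrite -big_split; apply: ler_prod => j _.
  by rewrite /e /chr; have [y -> /=] := ech k j; rewrite /bd; case: ifP.
have cardE : \sum_(f in family Q) (1 : R) = \prod_(j < s) (cardZ b m (w j))%:R.
  transitivity (\prod_(j < s) \sum_(x | Q j x) (1 : R)).
    rewrite bigA_distr_big_dep; apply: eq_bigr => f _.
    by rewrite big1.
  by apply: eq_bigr => j _; rewrite sumr_const /cardZ cardsE.
have card_gt0 : 0 < \prod_(j < s) (cardZ b m (w j))%:R :> R.
  by apply: prodr_gt0 => j _; rewrite ltr0n cardZ_gt0.
(* If every admissible vector exceeded [B], the total would exceed the number of vectors times [B];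
   that number is positive, so the inequality is strict. *)
have [f fQ fB] : exists2 f, f \in family Q & latsum N gamma (zz f) <= B.
  apply/exists_inP; apply: contraT => /exists_inPn far.
  move: average; rewrite leNgt => /negP; case.
  rewrite -cardE mulr_suml; apply: ltr_sum => [|f fQ]; last by rewrite mul1r ltNge far.
  by apply: contraT => none; move: card_gt0; rewrite -cardE big_hasC // ltxx.
exists (fun j => f j : nat); split; first by move=> j; have /familyP/(_ j) := fQ.
have gamma_ge0 j : 0 <= gamma j by case/andP: (g01 j).
apply: le_trans (Dstar_le N0 gamma_ge0 (zz f)) _.
rewrite lerD2l ler_pM2l ?invr_gt0 // lerD2r (le_trans fB) // -mulrDr /B.
rewrite ler_pM2l ?invr_gt0 // S_NE // -/S.
under [X in _ <= _ + X]eq_bigr => p _ do rewrite -mulrA.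
rewrite -(sum_by_logn m _ (fun p => \prod_(j < s | (m - p <= w j)%N) (beta j + gamma j * S) *
   \prod_(j < s | (w j < m - p)%N) beta j) hb).
apply: ler_sum => k _; rewrite le_eqVlt; apply/orP; left; apply/eqP.
case: eqVneq => [k0|k0].
  by apply: eq_bigr => j _; rewrite /bd k0 mul0n dvdn0.
rewrite (bigID (fun j : 'I_s => m - logn b k <= w j)%N) /=.
(* [N = b^m] divides [k * b^(w j)] exactly when the valuation [logn b k + w j] reaches [m]. *)
have bdE j : bd k j = if (m - logn b k <= w j)%N then beta j + gamma j * S else beta j.
  have bw0 : (0 < b ^ w j)%N by rewrite expn_gt0 b0.
  have k0' : (0 < k)%N by rewrite lt0n.
  by rewrite /bd /N pfactor_dvdn ?muln_gt0 ?k0' // lognM // pfactorK // leq_subLR.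
congr (_ * _); first by apply: eq_bigr => j hj; rewrite bdE hj.
by apply: eq_big => [j|j /negbTE hj]; rewrite ?ltnNge // bdE hj.
Qed.
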